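(* Let $G$ be a connected Lie group with locally convex Lie algebra $\mathfrak{g}$, and suppose that $\mathfrak{g}$ is either nilpotent or $2$-step solvable, i.e., $[\mathfrak{g},\mathfrak{g}]$ is abelian. Then $\mathfrak{g}'_{\rm seq}\subseteq[\mathfrak{g},\mathfrak{g}]^\perp$, i.e., all semi-equicontinuous coadjoint orbits are trivial (one-point sets). If there exists a pointed $\mathrm{Ad}(G)$-invariant convex cone $W\subseteq\mathfrak{g}$ with non-empty interior, then $\mathfrak{g}$ is abelian.
   Context: $G$ may be infinite-dimensional (modelled on a locally convex space) and has an exponential function. $\mathfrak{g}'$ is the topological dual, the coadjoint action is $\mathrm{Ad}^*_g\lambda=\lambda\circ\mathrm{Ad}_{g^{-1}}$, and $\mathcal{O}_\lambda=\mathrm{Ad}^*(G)\lambda$. A subset $C\subseteq\mathfrak{g}'$ is semi-equicontinuous if $s_C(x)=\sup_{\lambda\in C}\lambda(x)$ is bounded on some non-empty open subset of $\mathfrak{g}$. $\mathfrak{g}'_{\rm seq}$ is the set of all $\lambda\in\mathfrak{g}'$ for which $\mathcal{O}_\lambda$ is semi-equicontinuous. $[\mathfrak{g},\mathfrak{g}]^\perp$ is the set of functionals in $\mathfrak{g}'$ vanishing on $[\mathfrak{g},\mathfrak{g}]$. A convex cone $W$ is pointed if $\overline{W}\cap-\overline{W}=\{0\}$. *)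

(* Defs.v *)
From HB Require Import structures.
From mathcomp Require Import all_boot all_order all_algebra.
From mathcomp Require Import all_classical all_reals all_analysis.

Set Implicit Arguments.
Unset Strict Implicit.
Unset Printing Implicit Defensive.
Import Order.TTheory GRing.Theory Num.Theory.
Import numFieldNormedType.Exports.
Local Open Scope classical_set_scope.
Local Open Scope ring_scope.

(* MathComp-Analysis' 'D_v f requires normed modules, and lim a pointed
   type, hence the directional derivatives between locally convex spaces
   below. *)
Section Calculus.
Variables (R : realType).

Definition diff_quotient (E F : tvsType R) (f : E -> F) (a v : E) : R -> F :=
  fun h => h^-1 *: (f (a + h *: v) - f a).

Definition dderivable (E F : tvsType R) (f : E -> F) (a v : E) : Prop :=
  exists l : F, diff_quotient f a v h @[h --> 0^'] --> l.

Definition dderive (E F : tvsType R) (f : E -> F) (a v : E) : F :=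
  xget 0 [set l : F | diff_quotient f a v h @[h --> 0^'] --> l].

(* Bastiani (Keller's C^k_c) differentiability; U is meant to be open. *)
Fixpoint Ck_on (k : nat) (E F : tvsType R) (U : set E) (f : E -> F) : Prop :=
  match k with
  | 0 => forall x, U x -> {for x, continuous f}
  | k'.+1 => [/\ forall x, U x -> {for x, continuous f},
                 forall x v, U x -> dderivable f x v
               & @Ck_on k' (E * E)%type F (U `*` setT)
                   (fun p => dderive f p.1 p.2)]
  end.

Definition smooth_on (E F : tvsType R) (U : set E) (f : E -> F) : Prop :=
  forall k, Ck_on k U f.

End Calculus.

Section Manifolds.
Variables (R : realType).

Record chart (M : topologicalType) (E : tvsType R) := Chart {
  ch_dom : set M;
  ch_cod : set E;
  ch_map : M -> E;
  ch_inv : E -> M }.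

(* ch_map and ch_inv are total functions, only meaningful on ch_dom and
   ch_cod, where they are mutually inverse homeomorphisms. *)
Definition is_chart (M : topologicalType) (E : tvsType R) (c : chart M E) :=
  [/\ open (ch_dom c) /\ open (ch_cod c),
      forall p, ch_dom c p -> ch_cod c (ch_map c p) /\
                              ch_inv c (ch_map c p) = p,
      forall x, ch_cod c x -> ch_dom c (ch_inv c x) /\
                              ch_map c (ch_inv c x) = x,
      forall p, ch_dom c p -> {for p, continuous (ch_map c)}
    & forall x, ch_cod c x -> {for x, continuous (ch_inv c)}].

Definition smooth_in_charts (M N : topologicalType) (E F : tvsType R)
    (c : chart M E) (d : chart N F) (f : M -> N) : Prop :=
  smooth_on [set x | ch_cod c x /\ ch_dom d (f (ch_inv c x))]
    (fun x => ch_map d (f (ch_inv c x))).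

Definition is_atlas (M : topologicalType) (E : tvsType R)
    (A : set (chart M E)) : Prop :=
  [/\ forall c, A c -> is_chart c,
      forall p, exists2 c, A c & ch_dom c p
    & forall c d, A c -> A d -> smooth_in_charts c d id].

Definition smooth_map (M N : topologicalType) (E F : tvsType R)
    (A : set (chart M E)) (B : set (chart N F)) (f : M -> N) : Prop :=
  continuous f /\ forall c d, A c -> B d -> smooth_in_charts c d f.

Definition prod_chart (M N : topologicalType) (E F : tvsType R)
    (c : chart M E) (d : chart N F) : chart (M * N)%type (E * F)%type :=
  Chart (ch_dom c `*` ch_dom d) (ch_cod c `*` ch_cod d)
    (fun p => (ch_map c p.1, ch_map d p.2))
    (fun x => (ch_inv c x.1, ch_inv d x.2)).

Definition prod_atlas (M N : topologicalType) (E F : tvsType R)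
    (A : set (chart M E)) (B : set (chart N F)) :
    set (chart (M * N)%type (E * F)%type) :=
  [set prod_chart c d | c in A & d in B].

Definition tvs_atlas (E : tvsType R) : set (chart E E) :=
  [set Chart setT setT id id].

End Manifolds.
Arguments tvs_atlas {R} E.

(* No compatibility between the two structures is required here:
   it is part of is_lie_group. *)
#[short(type="groupTopologicalType")]
HB.structure Definition GroupTopological := {G of Group G & Topological G}.

Section LieGroups.
Variables (R : realType) (E : tvsType R) (G : groupTopologicalType).

Definition is_lie_group (A : set (chart G E)) : Prop :=
  [/\ hausdorff_space E /\ hausdorff_space G,
      is_atlas A,
      smooth_map (prod_atlas A A) A (fun p : G * G => (p.1 * p.2)%g)
    & smooth_map A A (fun g : G => g^-1%g)].

(* From here on, c is a chart around 1, and the tangent space of G at 1 is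
   identified with the model space E through the differential of c at 1. *)
Variable c : chart G E.

Definition chart1 : E := ch_map c 1%g.

Definition Ad (g : G) (x : E) : E :=
  dderive (fun p => ch_map c (g * ch_inv c p * g^-1)%g) chart1 x.

(* The left invariant vector field with value x at 1, read in the chart c:
   its value at p is T_1(L_g) x for g = ch_inv c p. *)
Definition left_inv_field (x : E) : E -> E :=
  fun p => dderive (fun q => ch_map c (ch_inv c p * ch_inv c q)%g) chart1 x.

Definition field_bracket (X Y : E -> E) : E -> E :=
  fun p => dderive Y p (X p) - dderive X p (Y p).

Definition lie_bracket (x y : E) : E :=
  field_bracket (left_inv_field x) (left_inv_field y) chart1.

Definition is_exponential (A : set (chart G E)) (e : E -> G) : Prop :=
  smooth_map (tvs_atlas E) A e /\
  forall x : E,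
    (forall s t : R, e ((s + t) *: x) = (e (s *: x) * e (t *: x))%g) /\
    diff_quotient (fun t : R^o => ch_map c (e ((t : R) *: x))) 0 1 h @[h --> 0^']
      --> x.

Definition has_exponential (A : set (chart G E)) : Prop :=
  exists e : E -> G, is_exponential A e.

Definition lin_span (S : set E) : set E :=
  [set x | exists n (a : 'I_n -> R) (s : 'I_n -> E),
     (forall i, S (s i)) /\ x = \sum_(i < n) a i *: s i].

Definition bracket_span (S T : set E) : set E :=
  lin_span [set lie_bracket x y | x in S & y in T].

Definition derived_algebra : set E := bracket_span setT setT.

Fixpoint lower_central (n : nat) : set E :=
  if n is n'.+1 then bracket_span setT (lower_central n') else setT.

Definition nilpotent_lie : Prop := exists n, lower_central n = [set 0].

Definition abelian_on (S : set E) : Prop :=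
  forall x y, S x -> S y -> lie_bracket x y = 0.

Definition top_dual : set (E -> R^o) :=
  [set l : E -> R^o | linear l /\ continuous l].

Definition coAd (g : G) (l : E -> R^o) : E -> R^o := l \o Ad (g^-1)%g.

Definition coadjoint_orbit (l : E -> R^o) : set (E -> R^o) :=
  [set coAd g l | g in [set: G]].

Definition support_fun (C : set (E -> R^o)) (x : E) : \bar R :=
  ereal_sup [set (l x : R)%:E | l in C].

Definition semi_equicontinuous (C : set (E -> R^o)) : Prop :=
  exists U : set E, [/\ open U, U !=set0 &
    exists M : R, forall x, U x -> (`|support_fun C x| <= M%:E)%E].

Definition dual_seq : set (E -> R^o) :=
  [set l : E -> R^o | top_dual l /\ semi_equicontinuous (coadjoint_orbit l)].

Definition annihilator (S : set E) : set (E -> R^o) :=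
  [set l : E -> R^o | top_dual l /\ forall x, S x -> l x = 0].

(* A cone is only required to be stable under positive scalars, so that
   it may or may not contain 0. *)
Definition convex_cone (W : set E) : Prop :=
  convex_set W /\ forall (t : R) x, 0 < t -> W x -> W (t *: x).

Definition pointed_cone (W : set E) : Prop :=
  closure W `&` (-%R @` closure W) = [set 0].

Definition Ad_invariant (W : set E) : Prop :=
  forall (g : G) x, W x -> W (Ad g x).

End LieGroups.

(* Main.v *)
Require Import Defs.
From mathcomp Require Import all_boot all_order all_algebra.
From mathcomp Require Import all_classical all_reals all_analysis.
From mathcomp Require Import ring lra.
Import Order.TTheory GRing.Theory Num.Theory.
Import numFieldNormedType.Exports.
Local Open Scope classical_set_scope.
Local Open Scope ring_scope.

(** The heart of the matter is one remark about an element [x] of the Lie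
    algebra and a continuous linear map [L].  Since the one-parameter group
    [exp (tx)] is commutative, [Ad (exp (tx))] commutes with [ad x], so that the
    curve [t |-> L (Ad (exp (tx)) y)] has second derivative
    [L ([x, [x, Ad (exp (tx)) y]])].  If [L] kills all [[x, [x, z]]], the curve
    is therefore affine, equal to [L y + t L [x, y]] ([Ad_exp_affine]).

    - For [L = l] in the dual with a semi-equicontinuous orbit, that affine
      function is bounded above for all [y] in a non-empty open set; its slope
      [l [x, y]] vanishes there, hence everywhere ([dual_seq_lie_bracket]).
    - For [L = id] and [w] in an invariant cone [W], the line [w + t [x, w]]
      stays in [W]; dividing by [|t|] shows that [[x, w]] and its opposite lie
      in the closure of [W], so that [[x, w] = 0] when [W] is pointed.  As [W]
      has an interior point, [ad x = 0]
      ([Ad_invariant_cone_lie_bracket]).  Running the argument on [W] itself,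
      rather than on its dual cone, spares the Hahn-Banach theorem.

    Both cases share the form: [L (ad x)^2 = 0] implies [L (ad x) = 0].  On
    a nilpotent or 2-step solvable algebra this implication alone makes [L] kill
    every bracket ([bracket_annihilated]).  If [[g, g]] is
    abelian, the implication applies to the elements of [[g, g]], and then to
    every [x] because [[x, [x, z]]] is, up to sign, a bracket with an element of
    [[g, g]].  If [g] is nilpotent, one descends the lower central series: when
    [L] kills [C^(n+2)], the implication applies to the elements of [C^n] and
    yields that [L] kills [C^(n+1)].

    Triviality of the orbits needs more than exponentials, whose images might
    not generate [G].  If [l] kills all brackets, [g |-> l (Ad g y)] has zero
    derivative along segments in a chart around 1, so the stabilizer of [l]
    contains a neighbourhood of 1; it is an open and closed subgroup of the
    connected group [G] ([Ad_stabilizer]).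

    What remains is to derive from the Bastiani calculus that [Ad] is a
    continuous linear action whose derivative at 1 is the bracket of left
    invariant vector fields ([Ad_lie_bracket]).  The means are a mean value
    theorem for curves in a locally convex space and a notion of strict
    differentiability, implied by [C^1], that composes without any estimate. *)

Set Implicit Arguments.
Unset Strict Implicit.
Unset Printing Implicit Defensive.

(** * Curves in locally convex spaces *)

Section TvsLimits.
Context {R : realType} {E : tvsType R}.

Lemma tvs_cvgD {T : Type} (F : set_system T) {FF : Filter F} (f g : T -> E)
    (a b : E) : f @ F --> a -> g @ F --> b -> (f x + g x) @[x --> F] --> a + b.
Proof. by move=> fa gb; apply: (cvg_comp2 fa gb (@add_continuous E (a, b))). Qed.

Lemma tvs_cvgZ {T : Type} (F : set_system T) {FF : Filter F} (k : T -> R)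
    (f : T -> E) (c : R) (a : E) :
  k @ F --> c -> f @ F --> a -> (k x *: f x) @[x --> F] --> c *: a.
Proof.
by move=> kc fa; apply: (cvg_comp2 kc fa (@scale_continuous R E (c, a))).
Qed.

Lemma tvs_cvgN {T : Type} (F : set_system T) {FF : Filter F} (f : T -> E)
    (a : E) : f @ F --> a -> (- f x) @[x --> F] --> - a.
Proof. by move=> fa; apply: (cvg_comp _ _ fa (@opp_continuous E a)). Qed.

Lemma tvs_cvgB {T : Type} (F : set_system T) {FF : Filter F} (f g : T -> E)
    (a b : E) : f @ F --> a -> g @ F --> b -> (f x - g x) @[x --> F] --> a - b.
Proof. by move=> fa gb; apply: tvs_cvgD => //; exact: tvs_cvgN. Qed.

(** Convexity without the bundled interval scalars of [convex_set], which would
    get in the way when the coefficient is a quotient. *)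
Definition convex_combinations_in (V : set E) :=
  forall u v (t : R), 0 <= t -> t <= 1 -> V u -> V v ->
    V (t *: u + (1 - t) *: v).

Lemma nbhs_convex_open (x : E) (V : set E) : nbhs x V ->
  exists C : set E, [/\ open C, C x, C `<=` V &
    convex_combinations_in C].
Proof.
move=> xV; have [B Bc [Bo Bb]] := @locally_convex R E.
have [C [BC Cx] CV] := Bb x V xV.
exists C; split=> //; first exact: Bo.
move=> u v t t0 t1 Cu Cv.
have t01 : Itv.spec (@Itv.num_sem R) (Itv.Real `[0%Z, 1%Z]) t.
  by apply/and3P; split; rewrite ?num_real// bnd_simp.
have := Bc C (mem_set BC) u v (Itv.mk t01) (mem_set Cu) (mem_set Cv).
by rewrite inE.
Qed.

End TvsLimits.

Section MeanValue.
Context {R : realType} {E : tvsType R}.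

Definition slope (g : R -> E) (s t : R) : E := (t - s)^-1 *: (g t - g s).

Lemma slopeC g s t : slope g s t = slope g t s.
Proof.
by rewrite /slope -opprB -(opprB (g s)) invrN scaleNr scalerN opprK.
Qed.

(** A slope over a union of two adjacent intervals is an average of the two
    slopes, and so stays in a convex set containing both. *)
Lemma slope_chasles g a b c : a < b -> b < c ->
  slope g a c = ((b - a) / (c - a)) *: slope g a b
    + (1 - (b - a) / (c - a)) *: slope g b c.
Proof.
move=> ab bc; rewrite /slope.
have ba0 : b - a != 0 by rewrite subr_eq0 gt_eqF.
have cb0 : c - b != 0 by rewrite subr_eq0 gt_eqF.
have ca0 : c - a != 0 by rewrite subr_eq0 gt_eqF// (lt_trans ab).
rewrite !scalerA.
have -> : (b - a) / (c - a) / (b - a) = (c - a)^-1 by field; apply/andP.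
have -> : (1 - (b - a) / (c - a)) / (c - b) = (c - a)^-1.
  by field; apply/andP.
by rewrite -scalerDr [X in _ = _ *: X]addrC addrA subrK.
Qed.

Definition curve_deriv (g : R -> E) (t : R) (l : E) :=
  h^-1 *: (g (t + h) - g t) @[h --> 0^'] --> l.

(** The derivative controls slopes on both sides of [t], which is what lets the
    supremum argument of [mean_value] go past every point. *)
Lemma curve_deriv_slope g t l (V : set E) : curve_deriv g t l -> nbhs l V ->
  exists2 d : R, 0 < d & forall s, s != t -> `|s - t| < d -> V (slope g t s).
Proof.
move=> gl lV; have [d /= d0 dV] := gl _ lV.
exists d => // s st sd; have := dV (s - t).
rewrite /= sub0r normrN subr_eq0 => /(_ sd st).
by rewrite (_ : t + (s - t) = s) // addrC subrK.
Qed.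

(** Consider the supremum of the [t] such that all slopes from [a] to a point
    up to [t] lie in [V].  Near it the slopes lie in [V] by differentiability,
    and adjacent slopes average inside [V] by convexity: so it has the same
    property, and it would not be the supremum if it were less than [b].
    Asking [V] to be a neighbourhood of the derivatives avoids closures and
    compactness. *)
Lemma mean_value (a b : R) (g g' : R -> E) (V : set E) : a < b ->
  convex_combinations_in V ->
  (forall t, a <= t <= b -> curve_deriv g t (g' t) /\ nbhs (g' t) V) ->
  V (slope g a b).
Proof.
move=> ab Vc gV.
have Vslope s t u : s < t -> t < u -> V (slope g s t) -> V (slope g t u) ->
    V (slope g s u).
  move=> st tu Vst Vtu; rewrite (slope_chasles _ st tu); apply: Vc => //.
    by rewrite divr_ge0// subr_ge0 ltW// (lt_trans st).
  rewrite ler_pdivrMr ?mul1r ?subr_gt0 ?(lt_trans st)//.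
  by rewrite lerB// ltW.
have near_slope t : a <= t <= b -> exists2 d : R, 0 < d &
    forall s, s != t -> `|s - t| < d -> V (slope g t s).
  by move=> /gV[gt tV]; exact: curve_deriv_slope gt tV.
pose S := [set t | a < t <= b /\ forall u, a < u <= t -> V (slope g a u)].
have ubS : ubound S b by move=> t [/andP[]].
have [t0 St0] : S !=set0.
  have [|d d0 dV] := near_slope a; first by rewrite lexx ltW.
  exists (Num.min b (a + d / 2)); split.
    by rewrite lt_min ab ltrDl divr_gt0//= ge_min lexx.
  move=> u /andP[au]; rewrite le_min => /andP[ub ud].
  by apply: dV; rewrite ?gt_eqF// gtr0_norm ?subr_gt0//; lra.
have supS : has_sup S by split; [exists t0|exists b].
pose s := sup S.
have as_ : a < s.
  by case: (St0) => /andP[at0 _] _; rewrite (lt_le_trans at0)//; exact: sup_upper_bound.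
have sb : s <= b by apply: ge_sup => //; exists t0.
have Vlt u : a < u -> u < s -> V (slope g a u).
  move=> au us; have [t St ut] := sup_gt (ex_intro _ t0 St0) us.
  by case: St => _; apply; rewrite au ltW.
have [|d d0 dV] := near_slope s; first by rewrite sb ltW.
have Vs : V (slope g a s).
  (* A point [u] below [s], close enough for the slope over [u, s] to be in [V]. *)
  pose u := Num.max ((a + s) / 2) (s - d / 2).
  have us : u < s by rewrite gt_max; apply/andP; split; lra.
  have au : a < u by rewrite lt_max; apply/orP; left; lra.
  have du : s - d / 2 <= u by rewrite le_max lexx orbT.
  apply: (Vslope _ u) => //; first exact: Vlt.
  by rewrite slopeC; apply: dV; rewrite ?lt_eqF// ltr0_norm ?subr_lt0//; lra.
move: sb; rewrite le_eqVlt => /predU1P[<-//|sb].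
pose t := Num.min b (s + d / 2).
have st : s < t by rewrite lt_min sb ltrDl divr_gt0.
suff /(sup_upper_bound supS) : S t by rewrite -/s leNgt st.
split; first by rewrite (lt_trans as_ st) ge_min lexx.
move=> u /andP[au]; rewrite le_min => /andP[ub ud].
have [us|su|->//] := ltgtP u s; first exact: Vlt.
apply: (Vslope _ s) => //.
by apply: dV; rewrite ?gt_eqF// gtr0_norm ?subr_gt0//; lra.
Qed.

End MeanValue.

Section Curves.
Context {R : realType}.

(** The form used for difference quotients, whose step may be negative. *)
Lemma mean_value_step (E : tvsType R) (h : R) (g g' : R -> E) (V : set E) :
  h != 0 -> convex_combinations_in V ->
  (forall t, `|t| <= `|h| -> curve_deriv g t (g' t) /\ nbhs (g' t) V) ->
  V (h^-1 *: (g h - g 0)).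
Proof.
rewrite neq_lt => /orP[h0|h0] Vc gV.
  have := @mean_value R E h 0 g g' V h0 Vc.
  rewrite slopeC /slope subr0; apply=> t /andP[ht t0]; apply: gV.
  by rewrite !ler0_norm ?lerN2// ltW.
have := @mean_value R E 0 h g g' V h0 Vc.
rewrite /slope subr0; apply=> t /andP[t0 ht]; apply: gV.
by rewrite !ger0_norm// ltW.
Qed.

Lemma curve_derivB (E : tvsType R) (f g : R -> E) t l m :
  curve_deriv f t l -> curve_deriv g t m ->
  curve_deriv (fun s => f s - g s) t (l - m).
Proof.
move=> fl gm; apply: cvg_trans (tvs_cvgB fl gm); apply: near_eq_cvg.
by apply: nearW => h; rewrite -scalerBr !opprD !opprK addrACA.
Qed.

Lemma curve_derivZ (E : tvsType R) (f : R -> E) (c : R) t l :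
  curve_deriv f t l -> curve_deriv (fun s => c *: f s) t (c *: l).
Proof.
have cc : (fun _ : R => c) @ (0 : R)^' --> c by exact: cvg_cst.
move=> fl; apply: cvg_trans (tvs_cvgZ cc fl); apply: near_eq_cvg.
by apply: nearW => h; rewrite -scalerBr !scalerA mulrC.
Qed.

Lemma hausdorff_eq0 (F : tvsType R) (x : F) : hausdorff_space F ->
  (forall V, nbhs (0 : F) V -> V x) -> x = 0.
Proof.
move=> hF xV; apply/esym/hF => V W V0 xW; exists x; split; first exact: xV.
exact: nbhs_singleton.
Qed.

(** By the mean value theorem the slope lies in every convex neighbourhood
    of 0, so it is 0 in a Hausdorff space. *)
Lemma curve_const (F : tvsType R) (g : R -> F) (a b : R) :
  hausdorff_space F -> (forall t, a <= t <= b -> curve_deriv g t 0) ->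
  a <= b -> g a = g b.
Proof.
move=> hF gd; rewrite le_eqVlt => /predU1P[->//|ab].
suff /eqP : slope g a b = 0.
  rewrite scaler_eq0 invr_eq0 subr_eq0 gt_eqF//= subr_eq0.
  by move=> /eqP.
apply: hausdorff_eq0 => // V /nbhs_convex_open[C [Co C0 CV Cc]]; apply: CV.
apply: (mean_value (g' := fun=> 0)) => // t /gd gt; split => //.
exact: open_nbhs_nbhs.
Qed.

Lemma curve_const_line (F : tvsType R) (g : R -> F) (t : R) :
  hausdorff_space F -> (forall s, curve_deriv g s 0) -> g t = g 0.
Proof.
move=> hF gd; have [t0|t0] := leP t 0; first by apply: curve_const.
by apply/esym/curve_const => //; exact: ltW.
Qed.

Lemma curve_deriv_scale (F : tvsType R) (v : F) (t : R) :
  curve_deriv (fun s => s *: v) t v.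
Proof.
have vc : (fun _ : R => v) @ (0 : R)^' --> v by exact: cvg_cst.
apply: cvg_trans vc; apply: near_eq_cvg; near=> h.
have h0 : h != 0 by near: h; exact: nbhs_dnbhs_neq.
by rewrite scalerDl addrAC subrr add0r scalerA mulVf// scale1r.
Unshelve. all: by end_near. Qed.

Lemma curve_deriv_linear (E F : tvsType R) (L : E -> F) (g : R -> E) t l :
  linear L -> continuous L -> curve_deriv g t l ->
  curve_deriv (L \o g) t (L l).
Proof.
move=> Llin Lc gl.
have : L (h^-1 *: (g (t + h) - g t)) @[h --> 0^'] --> L l.
  exact: cvg_comp gl (Lc l).
apply: cvg_trans; apply: near_eq_cvg; apply: nearW => h /=.
by rewrite (GRing.scalable_linear Llin) (GRing.zmod_morphism_linear Llin).
Qed.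

Lemma cvg_dnbhs {T : Type} (F : set_system T) (h : T -> R) (x : R) :
  h @ F --> x^' -> h @ F --> x.
Proof. by move=> hx; apply: cvg_trans hx (@nbhs_dnbhs R x). Qed.

(** Every vector is a multiple of a difference of two points of [U]. *)
Lemma linear_eq0_nbhs (E F : tvsType R) (f : E -> F) (a : E) (U : set E) :
  linear f -> nbhs a U -> (forall x, U x -> f x = 0) -> forall x, f x = 0.
Proof.
move=> flin aU fU x.
have ac : (h *: x + a) @[h --> (0 : R)^'] --> a.
  rewrite -[a in X in _ --> X]add0r -(scale0r x); apply: tvs_cvgD => //.
    by apply: tvs_cvgZ; [exact: cvg_dnbhs|exact: cvg_cst].
  exact: cvg_cst.
have hU : \forall h \near (0 : R)^', U (h *: x + a) by exact: ac _ aU.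
have [h [/= Uh h0]] := filter_ex (filterI hU (nbhs_dnbhs_neq (0 : R))).
have := fU _ Uh; rewrite flin (fU a (nbhs_singleton aU)) addr0.
by move/eqP; rewrite scaler_eq0 (negPf h0) => /eqP.
Qed.

End Curves.

(** * Strict differentiability and Schwarz's theorem *)

Section StrictDifferentiability.
Context {R : realType}.

(** The base point, the direction and the non-zero step of a difference
    quotient tend to [a], [v] and 0 independently. *)
Definition at_point_direction (E : tvsType R) (a v : E) :
  set_system (E * E * R) := filter_prod (nbhs (a, v)) (0 : R)^'.

Global Instance at_point_direction_filter (E : tvsType R) (a v : E) :
  Filter (at_point_direction a v).
Proof. exact: filter_prod_filter. Qed.

Lemma cvg_point (E : tvsType R) (a v : E) :
  (fun q => q.1.1) @ at_point_direction a v --> a.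
Proof.
by apply: cvg_comp; [apply: (@cvg_fst _ _ _ _ _)|apply: (@cvg_fst _ _ _ _ _)].
Qed.

Lemma cvg_direction (E : tvsType R) (a v : E) :
  (fun q => q.1.2) @ at_point_direction a v --> v.
Proof.
by apply: cvg_comp; [apply: (@cvg_fst _ _ _ _ _)|apply: (@cvg_snd _ _ _ _ _)].
Qed.

Lemma cvg_step (E : tvsType R) (a v : E) :
  (fun q => q.2) @ at_point_direction a v --> (0 : R)^'.
Proof. by apply: (@cvg_snd _ _ _ _ _). Qed.

Lemma near_step_neq0 (E : tvsType R) (a v : E) :
  \forall q \near at_point_direction a v, q.2 != 0.
Proof. exact: (@cvg_step E a v _ (nbhs_dnbhs_neq (0 : R))). Qed.

(** Strict differentiability in the sense of continuous convergence: the base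
    point and the direction move along with the step.  Since the difference
    quotient of a composite is literally the difference quotient of the outer
    map, at a moving point and in a moving direction, the chain rule needs no
    remainder estimate. *)
Definition strict_diff (E F : tvsType R) (f : E -> F) (a : E) (L : E -> F) :=
  {for a, continuous f} /\ forall v,
    (fun q : E * E * R => q.2^-1 *: (f (q.1.1 + q.2 *: q.1.2) - f q.1.1))
      @ at_point_direction a v --> L v.

Lemma cvg_shift (E : tvsType R) {T : Type} (F : set_system T) {FF : Filter F}
    (p w : T -> E) (h : T -> R) (a v : E) :
  p @ F --> a -> w @ F --> v -> h @ F --> (0 : R)^' ->
  (p x + h x *: w x) @[x --> F] --> a.
Proof.
move=> pa wv h0; rewrite -[a in X in _ --> X]addr0 -(scale0r v).
by apply: tvs_cvgD => //; apply: tvs_cvgZ => //; exact: cvg_dnbhs.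
Qed.

(** [strict_diff] along an arbitrary filter: the workhorse form. *)
Lemma strict_diff_cvg (E F : tvsType R) (f : E -> F) (a v : E) (L : E -> F)
    {T : Type} (FF : set_system T) {FFF : Filter FF}
    (p w : T -> E) (h : T -> R) :
  strict_diff f a L -> p @ FF --> a -> w @ FF --> v -> h @ FF --> (0 : R)^' ->
  (h x)^-1 *: (f (p x + h x *: w x) - f (p x)) @[x --> FF] --> L v.
Proof.
move=> [_ /(_ v) fL] pa wv h0.
have pwh : (fun x => (p x, w x, h x)) @ FF --> at_point_direction a v.
  apply: (@cvg_pair _ _ _ FF (nbhs (a, v)) (0 : R)^' _ _ _
            (fun x => (p x, w x)) h) => //.
  exact: cvg_pair.
exact: cvg_comp pwh fL.
Qed.

Lemma strict_diff_cvg_dir (E F : tvsType R) (f : E -> F) (a v : E)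
    (L : E -> F) :
  strict_diff f a L -> diff_quotient f a v h @[h --> 0^'] --> L v.
Proof.
move=> fL; apply: strict_diff_cvg fL _ _ _; first exact: cvg_cst.
  exact: cvg_cst.
exact: cvg_id.
Qed.

Lemma dderiveE (E F : tvsType R) (f : E -> F) (a v : E) (l : F) :
  hausdorff_space F -> diff_quotient f a v h @[h --> 0^'] --> l ->
  dderive f a v = l.
Proof.
move=> hF fl; apply: (cvg_unique hF _ fl).
have := @xgetPex _ (0 : F) [set l : F | diff_quotient f a v h @[h --> 0^'] --> l].
by apply; exists l.
Qed.

Lemma strict_diffE (E F : tvsType R) (f : E -> F) (a : E) (L : E -> F) :
  hausdorff_space F -> strict_diff f a L -> dderive f a = L.
Proof.
by move=> hF fL; apply/funext => v; apply: dderiveE => //;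
  exact: strict_diff_cvg_dir.
Qed.

Lemma strict_diff_unique (E F : tvsType R) (f : E -> F) (a v : E) (l : F)
    (L : E -> F) : hausdorff_space F -> strict_diff f a L ->
  diff_quotient f a v h @[h --> 0^'] --> l -> L v = l.
Proof.
by move=> hF fL fl; rewrite -(strict_diffE hF fL); exact: dderiveE.
Qed.

Lemma strict_diff_near (E F : tvsType R) (f g : E -> F) (a : E) (L : E -> F) :
  (\forall x \near a, f x = g x) -> strict_diff f a L -> strict_diff g a L.
Proof.
move=> fg fL; split.
  case: fL => fc _; have fga : f a = g a := nbhs_singleton fg.
  suff : g @ a --> f a by rewrite fga.
  apply: cvg_trans fc; apply: near_eq_cvg.
  exact: fg.
move=> v; case: fL => _ /(_ v) fL; apply: cvg_trans fL; apply: near_eq_cvg.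
have fg0 := @cvg_point E a v _ fg.
have /(_ _ fg) fgh :
    (fun q => q.1.1 + q.2 *: q.1.2) @ at_point_direction a v --> a.
  exact: cvg_shift (@cvg_point E a v) (@cvg_direction E a v) (@cvg_step E a v).
by apply: (@filterS2 _ (at_point_direction a v) _ _ _ _ _ fg0 fgh) => q /= -> ->.
Qed.

(** The chain rule: for a step [h] in direction [w] at [p], put
    [w' := h^-1 (f (p + h w) - f p)]; then [f (p + h w) = f p + h w'], and [w']
    tends to [L v]. *)
Lemma strict_diff_comp (E F H : tvsType R) (f : E -> F) (g : F -> H) (a : E)
    (L : E -> F) (M : F -> H) :
  strict_diff f a L -> strict_diff g (f a) M ->
  strict_diff (g \o f) a (M \o L).
Proof.
move=> fL gM; split; first by apply: continuous_comp; [case: fL|case: gM].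
move=> v.
have h0 := @cvg_step E a v.
have pa : (fun q => f q.1.1) @ at_point_direction a v --> f a.
  by apply: cvg_comp (@cvg_point E a v) _; case: fL.
have wv := (proj2 fL v).
apply: cvg_trans (strict_diff_cvg gM pa wv h0); apply: near_eq_cvg.
apply: (filterS _ (@near_step_neq0 E a v)) => -[[p w] h] /= hn0.
by rewrite scalerA mulfV// scale1r [f p + _]addrC subrK.
Qed.

Lemma strict_diff_pair (E F H : tvsType R) (f : E -> F) (g : E -> H) (a : E)
    (L : E -> F) (M : E -> H) :
  strict_diff f a L -> strict_diff g a M ->
  strict_diff (fun x => (f x, g x)) a (fun v => (L v, M v)).
Proof.
move=> [fc fL] [gc gM]; split; first exact: cvg_pair.
by move=> v; exact: cvg_pair (fL v) (gM v).
Qed.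

Lemma linear_strict_diff (E F : tvsType R) (f : E -> F) (a : E) :
  linear f -> continuous f -> strict_diff f a f.
Proof.
move=> lf cf; split; first exact: cf.
move=> v; have wv : (fun q => f q.1.2) @ at_point_direction a v --> f v.
  by apply: cvg_comp (@cvg_direction E a v) _; exact: cf.
apply: cvg_trans wv; apply: near_eq_cvg.
apply: (filterS _ (@near_step_neq0 E a v)) => -[[p w] h] /= hn0.
by rewrite [p + _]addrC lf addrK scalerA mulVf// scale1r.
Qed.

Lemma strict_diff_id (E : tvsType R) (a : E) : strict_diff id a id.
Proof. by apply: linear_strict_diff => // x; exact: cvg_id. Qed.

Lemma strict_diff_cst (E F : tvsType R) (a : E) (b : F) :
  strict_diff (fun=> b) a (fun=> 0).
Proof.
split; first exact: cvg_cst.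
move=> v.
have c0 : (fun=> 0 : F) @ at_point_direction a v --> (0 : F) by exact: cvg_cst.
apply: cvg_trans c0; apply: near_eq_cvg.
by apply: nearW => q; rewrite /= subrr scaler0.
Qed.

(** Additivity uses the moving base point: the increment along [w + v] is the
    increment along [v] from [a] followed by the one along [w] from
    [a + h v]. *)
Lemma strict_diff_linear (E F : tvsType R) (f : E -> F) (a : E) (L : E -> F) :
  hausdorff_space F -> strict_diff f a L -> linear L.
Proof.
move=> hF fL.
have LZ c u : L (c *: u) = c *: L u.
  have [->|c0] := eqVneq c 0.
    rewrite !scale0r; apply: (strict_diff_unique hF fL).
    have c0 : (fun=> 0 : F) @ (0 : R)^' --> (0 : F) by exact: cvg_cst.
    apply: cvg_trans c0; apply: near_eq_cvg; apply: nearW => h.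
    by rewrite /diff_quotient scaler0 addr0 subrr scaler0.
  apply: (strict_diff_unique hF fL).
  have hc : (h * c) @[h --> (0 : R)^'] --> (0 : R)^'.
    move=> P [d /= d0 dP]; exists (d / `|c|); first by rewrite /= divr_gt0 ?normr_gt0.
    move=> h /=; rewrite sub0r normrN ltr_pdivlMr ?normr_gt0// -normrM => hd h0.
    by apply: dP; rewrite ?mulf_neq0//= sub0r normrN.
  have ac : (fun _ : R => a) @ (0 : R)^' --> a by exact: cvg_cst.
  have uc : (fun _ : R => u) @ (0 : R)^' --> u by exact: cvg_cst.
  apply: cvg_trans (tvs_cvgZ (cvg_cst c) (strict_diff_cvg fL ac uc hc)).
  apply: near_eq_cvg; near=> h.
  rewrite /diff_quotient scalerA invfM mulrCA mulfV// mulr1.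
  by rewrite [h *: (c *: u)]scalerA.
move=> c u v; rewrite -LZ; set w := c *: u.
apply: (strict_diff_unique hF fL).
have vc : (fun _ : R => v) @ (0 : R)^' --> v by exact: cvg_cst.
have ac : (fun _ : R => a) @ (0 : R)^' --> a by exact: cvg_cst.
have wc : (fun _ : R => w) @ (0 : R)^' --> w by exact: cvg_cst.
have h0 : (fun h : R => h) @ (0 : R)^' --> (0 : R)^' by exact: cvg_id.
apply: cvg_trans (tvs_cvgD (strict_diff_cvg fL (cvg_shift ac vc h0) wc h0)
   (strict_diff_cvg fL ac vc h0)).
apply: near_eq_cvg; near=> h.
rewrite -scalerDr addrA subrK /diff_quotient.
by rewrite -addrA -scalerDr [v + w]addrC.
Unshelve. all: by end_near. Qed.

(** The quotients at the fixed point [a] in directions near [v] lie eventually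
    in a given closed neighbourhood of [L v], and so do their limits; closed
    neighbourhoods suffice because a uniform space is regular. *)
Lemma strict_diff_continuous (E F : tvsType R) (f : E -> F) (a : E)
    (L : E -> F) : strict_diff f a L -> continuous L.
Proof.
move=> fL v V /(@uniform_regular F)[V' LV' V'V].
have [_ /(_ v) /(_ _ LV') [[P Q] /= [Pav Q0] PQ]] := fL.
case: Pav => [[A B] /= [Aa Bv] AB].
apply: filterS Bv => w Bw /=; apply: V'V.
apply: (closed_cvg (closure V') _ _ (L w) (strict_diff_cvg_dir fL)).
  exact: closed_closure.
apply: filterS Q0 => h Qh; apply: subset_closure.
by apply: (PQ (a, w, h)); split => //=; apply: AB; split => //=; exact: nbhs_singleton.
Qed.

End StrictDifferentiability.

Section ContinuouslyDifferentiable.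
Context {R : realType}.

Lemma curve_deriv_line (E F : tvsType R) (f : E -> F) (p w : E) (s : R) :
  dderivable f (p + s *: w) w ->
  curve_deriv (fun t => f (p + t *: w)) s (dderive f (p + s *: w) w).
Proof.
move=> fd; have := xgetPex (0 : F) fd; apply: cvg_trans; apply: near_eq_cvg.
by apply: nearW => h; rewrite /diff_quotient scalerDl addrA.
Qed.

Lemma strict_diff_dderivable (E F : tvsType R) (f : E -> F) a v L :
  strict_diff f a L -> dderivable f a v.
Proof. by move=> fL; exists (L v); exact: strict_diff_cvg_dir. Qed.

(** The mean value theorem along the segment from [p] to [p + h w] puts the
    difference quotient in any convex neighbourhood of [df (a, v)] containing the
    values of [df] along that segment. *)
Lemma C1_strict_diff (E F : tvsType R) (f : E -> F) (U : set E) (a : E) :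
  {for a, continuous f} -> nbhs a U ->
  (forall p v, U p -> dderivable f p v) ->
  (forall v, {for (a, v), continuous (fun p : E * E => dderive f p.1 p.2)}) ->
  strict_diff f a (dderive f a).
Proof.
move=> fa aU fd df; split=> // v V /nbhs_convex_open[C [Co Ca CV Cc]].
pose FF := filter_prod (nbhs (a, v)) (nbhs (0 : R)).
have FFF : Filter FF by exact: filter_prod_filter.
have FFw : (fun q : E * E * R => q.1.2) @ FF --> v.
  by apply: cvg_comp; [apply: (@cvg_fst _ _ _ _ _)|apply: (@cvg_snd _ _ _ _ _)].
have FFp : (fun q : E * E * R => q.1.1 + q.2 *: q.1.2) @ FF --> a.
  rewrite -[a in X in _ --> X]addr0 -(scale0r v); apply: tvs_cvgD.
    by apply: cvg_comp;
      [apply: (@cvg_fst _ _ _ _ _)|apply: (@cvg_fst _ _ _ _ _)].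
  by apply: tvs_cvgZ => //; apply: (@cvg_snd _ _ _ _ _).
have FFC : (fun q : E * E * R =>
    dderive f (q.1.1 + q.2 *: q.1.2) q.1.2) @ FF --> dderive f a v.
  by apply: (cvg_comp2 FFp FFw (df v)).
have aC : nbhs (dderive f a v) C by exact: open_nbhs_nbhs.
have [[P Q] /= [Pav [d /= d0 dQ]] PQ] := @filterI _ FF _ _ _ (FFp _ aU) (FFC _ aC).
exists (P, [set h : R | h != 0 /\ `|h| < d]).
  by split=> //; exists d => // h /=; rewrite sub0r normrN => hd hn0; split.
move=> [[p w] h] /= [Ppw [h0 hd]]; apply: CV.
have := @mean_value_step _ F h (fun s => f (p + s *: w))
  (fun s => dderive f (p + s *: w) w) C h0 Cc.
rewrite scale0r addr0; apply => t th.
have [Up Cp] : U (p + t *: w) /\ C (dderive f (p + t *: w) w).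
  apply: (PQ (p, w, t)); split=> //; apply: dQ.
  by rewrite /= sub0r normrN (le_lt_trans th).
split; last exact: open_nbhs_nbhs.
by apply: curve_deriv_line; exact: fd.
Qed.

Lemma Ck1_strict_diff (E F : tvsType R) (U : set E) (f : E -> F) (a : E) :
  open U -> Ck_on 1 U f -> U a -> strict_diff f a (dderive f a).
Proof.
move=> Uo [fc fd dfc] Ua; apply: (@C1_strict_diff _ _ f U) => //.
- exact: fc.
- exact: open_nbhs_nbhs.
- by move=> v; apply: dfc.
Qed.

Lemma Ck2_strict_diff (E F : tvsType R) (U : set E) (f : E -> F) (a v : E) :
  open U -> Ck_on 2 U f -> U a ->
  strict_diff (fun p : E * E => dderive f p.1 p.2) (a, v)
    (dderive (fun p : E * E => dderive f p.1 p.2) (a, v)).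
Proof.
move=> Uo [_ _ dfC] Ua; apply: Ck1_strict_diff dfC _ => //.
rewrite openE => -[p w] [/= Up _]; exists (U, setT) => //=.
by split; [exact: open_nbhs_nbhs|exact: filterT].
Qed.

(** The second difference is an increment of the curve
    [t |-> f (a + h w + t v) - f (a + t v)], whose derivative is an increment of
    [p |-> df (p, v)] in direction [w]; strict differentiability of [df] controls
    it uniformly for [t] between 0 and [h]. *)
Lemma second_difference_cvg (E F : tvsType R) (f : E -> F) (U : set E)
    (a v w : E) (D : E * E -> F) :
  nbhs a U -> (forall p, U p -> strict_diff f p (dderive f p)) ->
  strict_diff (fun p : E * E => dderive f p.1 p.2) (a, v) D ->
  h^-1 *: (h^-1 *: (f (a + h *: w + h *: v) - f (a + h *: v))
           - h^-1 *: (f (a + h *: w) - f a)) @[h --> 0^'] --> D (w, 0).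
Proof.
move=> aU fU [_ /(_ (w, 0)) dfD] V /nbhs_convex_open[C [Co Ca CV Cc]].
have aC : nbhs (D (w, 0)) C by exact: open_nbhs_nbhs.
have [[P Q] /= [[[P1 P2] /= [P1a P2w] P12] [d /= d0 dQ]] PQ] := dfD _ aC.
have FFp : (fun q : R * R => a + q.1 *: w + q.2 *: v) @
    filter_prod (nbhs (0 : R)) (nbhs (0 : R)) --> a.
  rewrite -[a in X in _ --> X]addr0 -(scale0r v).
  rewrite -[a in X in _ --> X]addr0 -(scale0r w).
  apply: tvs_cvgD; last first.
    by apply: tvs_cvgZ; [apply: (@cvg_snd _ _ _ _ _)|exact: cvg_cst].
  apply: tvs_cvgD; first exact: cvg_cst.
  by apply: tvs_cvgZ; [apply: (@cvg_fst _ _ _ _ _)|exact: cvg_cst].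
have FFq : (fun q : R => (a + q *: v, v)) @ nbhs (0 : R) --> (a, v).
  apply: cvg_pair; last exact: cvg_cst.
  rewrite -[a in X in _ --> X]addr0 -(scale0r v).
  apply: tvs_cvgD; first exact: cvg_cst.
  by apply: tvs_cvgZ; [exact: cvg_id|exact: cvg_cst].
have [[Q1 Q2] /= [[d1 /= d10 dQ1] [d2 /= d20 dQ2]] Q12] := FFp _ aU.
have [d3 /= d30 dQ3] := FFq _ P1a.
pose e := Num.min (Num.min d d1) (Num.min d2 d3).
have e0 : 0 < e by rewrite !lt_min d0 d10 d20 d30.
exists e => // h /=; rewrite sub0r normrN => he h0; apply: CV.
have := @mean_value_step _ F h
  (fun t => h^-1 *: (f (a + h *: w + t *: v) - f (a + t *: v)))
  (fun t => h^-1 *: (dderive f (a + h *: w + t *: v) v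
                     - dderive f (a + t *: v) v)) C h0 Cc.
rewrite scale0r !addr0; apply => t th.
have := he; have := le_lt_trans th he; rewrite !lt_min.
move=> /andP[/andP[td td1] /andP[td2 td3]] /andP[/andP[hd hd1] /andP[hd2 hd3]].
split.
  apply: curve_derivZ; apply: curve_derivB; apply: curve_deriv_line.
    apply: strict_diff_dderivable; apply: fU.
    by apply: (Q12 (h, t)); split; [apply: dQ1|apply: dQ2];
      rewrite /= sub0r normrN.
  apply: strict_diff_dderivable; apply: fU.
  have := Q12 (0, t); rewrite /= scale0r addr0; apply.
  by split; [apply: dQ1|apply: dQ2];
    rewrite /= sub0r normrN// normr0.
apply: open_nbhs_nbhs; split => //.
have := PQ ((a + t *: v, v), (w, 0), h); rewrite /= scaler0 addr0.
rewrite [a + t *: v + _]addrAC; apply; split; last first.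
  by apply: dQ => //=; rewrite sub0r normrN.
apply: P12; split; last exact: nbhs_singleton.
by apply: dQ3; rewrite /= sub0r normrN.
Qed.

(** Schwarz: the second difference does not depend on the order of [v] and
    [w]. *)
Lemma dderive_symmetric (E F : tvsType R) (f : E -> F) (U : set E)
    (a v w : E) (D : E -> E * E -> F) :
  hausdorff_space F ->
  nbhs a U -> (forall p, U p -> strict_diff f p (dderive f p)) ->
  (forall v, strict_diff (fun p : E * E => dderive f p.1 p.2) (a, v) (D v)) ->
  D v (w, 0) = D w (v, 0).
Proof.
move=> hF aU fU fD.
have Dv := @second_difference_cvg _ _ f U a v w (D v) aU fU (fD v).
have Dw := @second_difference_cvg _ _ f U a w v (D w) aU fU (fD w).
apply: (cvg_unique hF Dv); apply: cvg_trans Dw; apply: near_eq_cvg.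
apply: nearW => h; rewrite -!scalerBr [a + h *: w + _]addrAC.
congr (_ *: (_ *: _)); rewrite !opprD !opprK !addrA; congr (_ + _).
exact: addrAC.
Qed.

End ContinuouslyDifferentiable.

(** * Multiplication and inversion read in charts *)

Section LieGroupCharts.
Context {R : realType} {E : tvsType R} {G : groupTopologicalType}.
Context (A : set (chart G E)) (G_lie : is_lie_group A).

Let chart_of d : A d -> is_chart d.
Proof. by case: G_lie => _ [chA _ _] _ _; exact: chA. Qed.

Lemma chart_at (g : G) : exists2 d, A d & ch_dom d g.
Proof. by case: G_lie => _ [_ + _] _ _; exact. Qed.

Lemma near_ch_dom d g : A d -> ch_dom d g -> \forall h \near g, ch_dom d h.
Proof.
by move=> /chart_of[[dO _] _ _ _ _] dg; exact: open_nbhs_nbhs.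
Qed.

Lemma near_ch_cod d x : A d -> ch_cod d x -> \forall y \near x, ch_cod d y.
Proof.
by move=> /chart_of[[_ dO] _ _ _ _] dx; exact: open_nbhs_nbhs.
Qed.

Lemma ch_mapK d g : A d -> ch_dom d g -> ch_inv d (ch_map d g) = g.
Proof. by move=> /chart_of[_ dK _ _ _] /dK[]. Qed.

Lemma ch_invK d x : A d -> ch_cod d x -> ch_map d (ch_inv d x) = x.
Proof. by move=> /chart_of[_ _ dK _ _] /dK[]. Qed.

Lemma ch_map_cod d g : A d -> ch_dom d g -> ch_cod d (ch_map d g).
Proof. by move=> /chart_of[_ dK _ _ _] /dK[]. Qed.

Lemma ch_inv_dom d x : A d -> ch_cod d x -> ch_dom d (ch_inv d x).
Proof. by move=> /chart_of[_ _ dK _ _] /dK[]. Qed.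

Lemma ch_map_cvg d g : A d -> ch_dom d g -> ch_map d @ g --> ch_map d g.
Proof. by move=> /chart_of[_ _ _ dc _] /dc. Qed.

Lemma ch_inv_cvg d x : A d -> ch_cod d x -> ch_inv d @ x --> ch_inv d x.
Proof. by move=> /chart_of[_ _ _ _ dc] /dc. Qed.

Lemma mulg_cvg {T : Type} (F : set_system T) {FF : Filter F} (f g : T -> G)
    (x y : G) : f @ F --> x -> g @ F --> y -> (f t * g t)%g @[t --> F] --> (x * y)%g.
Proof.
move=> fx gy; case: G_lie => _ _ [mc _] _.
exact: (cvg_comp2 fx gy (mc (x, y))).
Qed.

Lemma invg_cvg {T : Type} (F : set_system T) {FF : Filter F} (f : T -> G)
    (x : G) : f @ F --> x -> (f t)^-1%g @[t --> F] --> (x^-1)%g.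
Proof.
by move=> fx; case: G_lie => _ _ _ [ic _]; exact: cvg_comp fx (ic x).
Qed.

Definition chart_mul (d e k : chart G E) (q : E * E) : E :=
  ch_map k (ch_inv d q.1 * ch_inv e q.2)%g.

Definition chart_mul_dom (d e k : chart G E) : set (E * E) :=
  [set q | (ch_cod d q.1 /\ ch_cod e q.2) /\
           ch_dom k (ch_inv d q.1 * ch_inv e q.2)%g].

Lemma chart_mul_dom_open d e k : A d -> A e -> A k ->
  open (chart_mul_dom d e k).
Proof.
move=> Ad Ae Ak; rewrite openE => -[x y] [/= [dx ey] kxy].
have xc : (fun q : E * E => ch_inv d q.1) @ (x, y) --> ch_inv d x.
  by apply: cvg_comp (ch_inv_cvg Ad dx); exact: cvg_fst.
have yc : (fun q : E * E => ch_inv e q.2) @ (x, y) --> ch_inv e y.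
  by apply: cvg_comp (ch_inv_cvg Ae ey); exact: cvg_snd.
have xyc := mulg_cvg xc yc.
rewrite /interior /chart_mul_dom; near=> q; split; last first.
  by near: q; exact: xyc _ (near_ch_dom Ak kxy).
split; near: q.
  have : (@fst E E) @ (x, y) --> x by exact: cvg_fst.
  by apply; exact: near_ch_cod.
have : (@snd E E) @ (x, y) --> y by exact: cvg_snd.
by apply; exact: near_ch_cod.
Unshelve. all: by end_near. Qed.

Lemma chart_mul_smooth d e k : A d -> A e -> A k ->
  smooth_on (chart_mul_dom d e k) (chart_mul d e k).
Proof.
move=> Ad Ae Ak; case: G_lie => _ _ [_ ms] _.
by apply: (ms (prod_chart d e) k) => //; exists d => //; exists e.
Qed.

Lemma chart_mul_strict_diff d e k q : A d -> A e -> A k ->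
  chart_mul_dom d e k q ->
  strict_diff (chart_mul d e k) q (dderive (chart_mul d e k) q).
Proof.
move=> Ad Ae Ak qU; apply: Ck1_strict_diff qU; first exact: chart_mul_dom_open.
exact: chart_mul_smooth.
Qed.

Definition chart_dmul (d e k : chart G E) (z : (E * E) * (E * E)) : E :=
  dderive (chart_mul d e k) z.1 z.2.

Lemma chart_dmul_strict_diff d e k q v : A d -> A e -> A k ->
  chart_mul_dom d e k q ->
  strict_diff (chart_dmul d e k) (q, v) (dderive (chart_dmul d e k) (q, v)).
Proof.
move=> Ad Ae Ak qU; apply: Ck2_strict_diff qU; first exact: chart_mul_dom_open.
exact: chart_mul_smooth.
Qed.

Lemma chart_inv_strict_diff d k x : A d -> A k -> ch_cod d x ->
  ch_dom k (ch_inv d x)^-1%g ->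
  exists L, strict_diff (fun y => ch_map k (ch_inv d y)^-1%g) x L.
Proof.
move=> Ad Ak dx kx; case: G_lie => _ _ _ [_ invs].
eexists; apply: (Ck1_strict_diff _ (invs d k Ad Ak 1%N)); last by split.
rewrite openE => y [dy ky].
have yc := invg_cvg (ch_inv_cvg Ad dy).
rewrite /interior; near=> z; split; near: z; first exact: near_ch_cod.
exact: yc _ (near_ch_dom Ak ky).
Unshelve. all: by end_near. Qed.

(** No single chart need contain [g], [x] and [k], so the map is written as two
    products read in charts around [g], [k] and [g x]. *)
Lemma translation_strict_diff c (g k : G) x : A c -> ch_cod c x ->
  ch_dom c (g * ch_inv c x * k)%g ->
  exists L, strict_diff (fun y => ch_map c (g * ch_inv c y * k)%g) x L.
Proof.
move=> Ac cx cgxk.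
have [d Ad dg] := chart_at g.
have [e Ae ek] := chart_at k.
have [b Ab bgx] := chart_at (g * ch_inv c x)%g.
have left_dom : chart_mul_dom d c b (ch_map d g, x).
  by split; [split => //; exact: ch_map_cod|rewrite /= ch_mapK].
have right_dom : chart_mul_dom b e c (chart_mul d c b (ch_map d g, x), ch_map e k).
  rewrite /chart_mul /= ch_mapK//; split => /=; first by split; exact: ch_map_cod.
  by rewrite !ch_mapK.
have left_diff := strict_diff_comp
  (strict_diff_pair (strict_diff_cst x (ch_map d g)) (strict_diff_id x))
  (chart_mul_strict_diff Ad Ac Ab left_dom).
have right_diff := strict_diff_comp
  (strict_diff_pair left_diff (strict_diff_cst x (ch_map e k)))
  (chart_mul_strict_diff Ab Ae Ac right_dom).
eexists; apply: strict_diff_near right_diff.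
have gxc : (g * ch_inv c y)%g @[y --> x] --> (g * ch_inv c x)%g.
  by apply: mulg_cvg; [exact: cvg_cst|exact: ch_inv_cvg].
have gxb : \forall y \near x, ch_dom b (g * ch_inv c y)%g.
  exact: gxc _ (near_ch_dom Ab bgx).
by apply: filterS gxb => y by_; rewrite /chart_mul /= !ch_mapK.
Qed.

End LieGroupCharts.

(** * The adjoint action and its derivative *)

Section AdjointAction.
Context {R : realType} {E : tvsType R} {G : groupTopologicalType}.
Context (A : set (chart G E)) (G_lie : is_lie_group A).
Context (c : chart G E) (Ac : A c) (c1 : ch_dom c 1%g).

Let hE : hausdorff_space E. Proof. by case: G_lie => -[]. Qed.

Let o : E := chart1 c.
Let m := chart_mul c c c.
Let dm := chart_dmul c c c.
Let U := chart_mul_dom c c c.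

Let co : ch_cod c o. Proof. exact: (ch_map_cod G_lie Ac c1). Qed.

Lemma ch_inv_chart1 : ch_inv c o = 1%g.
Proof. exact: (ch_mapK G_lie Ac c1). Qed.

Let ch_inv_cvg1 : ch_inv c @ o --> (1%g : G).
Proof. by rewrite -ch_inv_chart1; exact: (ch_inv_cvg G_lie Ac co). Qed.

(** Conjugation by [g] fixes 1 and is strictly differentiable there, with
    derivative [Ad g]: linearity, continuity and multiplicativity of [Ad] are then
    instances of the calculus above. *)
Lemma Ad_strict_diff g :
  strict_diff (fun p => ch_map c (g * ch_inv c p * g^-1)%g) o (Ad c g).
Proof.
have [|L fL] := translation_strict_diff G_lie (g := g) (k := (g^-1)%g) Ac co.
  by rewrite ch_inv_chart1 mulg1 mulgV.
suff -> : Ad c g = L by [].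
by apply/funext => x; rewrite /Ad (strict_diffE hE fL).
Qed.

Lemma Ad_linear g : linear (Ad c g).
Proof. exact: strict_diff_linear hE (Ad_strict_diff g). Qed.

Lemma Ad_continuous g : continuous (Ad c g).
Proof. exact: strict_diff_continuous (Ad_strict_diff g). Qed.

Let conj_chart1 g : ch_map c (g * ch_inv c o * g^-1)%g = o.
Proof. by rewrite ch_inv_chart1 mulg1 mulgV. Qed.

Let conj_cvg g : (g * ch_inv c p * g^-1)%g @[p --> o] --> (1%g : G).
Proof.
rewrite -(mulgV g) -[X in (X * _)%g](mulg1 g).
apply: (mulg_cvg G_lie); last exact: cvg_cst.
by apply: (mulg_cvg G_lie); [exact: cvg_cst|exact: ch_inv_cvg1].
Qed.

Let near_conj_dom g :
  \forall p \near o, ch_dom c (g * ch_inv c p * g^-1)%g.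
Proof. exact: (@conj_cvg g _ (near_ch_dom G_lie Ac c1)). Qed.

Let near_cod : \forall p \near o, ch_cod c p.
Proof. exact: (near_ch_cod G_lie Ac co). Qed.

Lemma Ad1 : Ad c 1%g = id.
Proof.
apply/funext => x; rewrite /Ad.
suff /(strict_diffE hE) -> :
    strict_diff (fun p => ch_map c (1 * ch_inv c p * 1^-1)%g) o id by [].
apply: strict_diff_near (strict_diff_id o).
apply: filterS near_cod => p cp.
by rewrite mul1g invg1 mulg1 (ch_invK G_lie Ac).
Qed.

Lemma AdM g h x : Ad c (g * h)%g x = Ad c g (Ad c h x).
Proof.
have gd := Ad_strict_diff g; rewrite -[X in strict_diff _ X](conj_chart1 h) in gd.
have := strict_diff_comp (Ad_strict_diff h) gd.
suff /strict_diff_near /[apply] /(strict_diffE hE) /(congr1 (@^~ x)) :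
    \forall p \near o, ((fun p => ch_map c (g * ch_inv c p * g^-1)%g) \o
    (fun p => ch_map c (h * ch_inv c p * h^-1)%g)) p =
    ch_map c (g * h * ch_inv c p * (g * h)^-1)%g by [].
apply: filterS (near_conj_dom h) => p hp /=.
by rewrite (ch_mapK G_lie Ac)// invgM !mulgA.
Qed.

Let U_l p : ch_cod c p -> U (p, o).
Proof.
move=> cp; split => /=; first by split.
by rewrite ch_inv_chart1 mulg1; exact: (ch_inv_dom G_lie Ac).
Qed.

Let U_r p : ch_cod c p -> U (o, p).
Proof.
move=> cp; split => /=; first by split.
by rewrite ch_inv_chart1 mul1g; exact: (ch_inv_dom G_lie Ac).
Qed.

Let m_l p : ch_cod c p -> m (p, o) = p.
Proof.
by move=> cp; rewrite /m /chart_mul /= ch_inv_chart1 mulg1 (ch_invK G_lie Ac).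
Qed.

Let m_r p : ch_cod c p -> m (o, p) = p.
Proof.
by move=> cp; rewrite /m /chart_mul /= ch_inv_chart1 mul1g (ch_invK G_lie Ac).
Qed.

Let m_diff q : U q -> strict_diff m q (fun v => dm (q, v)).
Proof. exact: (chart_mul_strict_diff G_lie). Qed.

Let dm_diff q v : U q -> strict_diff dm (q, v) (dderive dm (q, v)).
Proof. exact: (chart_dmul_strict_diff G_lie). Qed.

Let dm_linear q : U q -> linear (fun v => dm (q, v)).
Proof. by move=> qU; apply: strict_diff_linear hE (m_diff qU). Qed.

(** The partial differential of the product, as a restriction of the total
    one: only the latter is known to be differentiable again. *)
Lemma left_inv_fieldE p x : ch_cod c p ->
  left_inv_field c x p = dm ((p, o), (0, x)).
Proof.
move=> cp; have := strict_diff_comp (strict_diff_pair (strict_diff_cst o p)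
  (strict_diff_id o)) (m_diff (U_l cp)).
by move/(strict_diffE hE)/(congr1 (@^~ x)).
Qed.

Lemma left_inv_field_chart1 x : left_inv_field c x o = x.
Proof.
rewrite left_inv_fieldE//.
have := strict_diff_comp (strict_diff_pair (strict_diff_cst o o)
  (strict_diff_id o)) (m_diff (U_l co)).
suff /strict_diff_near /[apply] /(strict_diffE hE) : \forall p \near o,
    (m \o (fun p => (o, p))) p = id p.
  by move/(congr1 (@^~ x)) => /= <-; rewrite (strict_diffE hE (strict_diff_id o)).
by apply: filterS near_cod => p; exact: m_r.
Qed.

Let dm_chart1_l w : dm ((o, o), (w, 0)) = w.
Proof.
have := strict_diff_comp (strict_diff_pair (strict_diff_id o)
  (strict_diff_cst o o)) (m_diff (U_l co)).
suff /strict_diff_near /[apply] /(strict_diffE hE) : \forall p \near o,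
    (m \o (fun p => (p, o))) p = id p.
  by move/(congr1 (@^~ w)) => /= <-; rewrite (strict_diffE hE (strict_diff_id o)).
by apply: filterS near_cod => p; exact: m_l.
Qed.

Let near_inv_dom : \forall p \near o, ch_dom c (ch_inv c p)^-1%g.
Proof.
have ic : (ch_inv c p)^-1%g @[p --> o] --> (1^-1)%g.
  by apply: (invg_cvg G_lie); exact: ch_inv_cvg1.
by rewrite invg1 in ic; exact: ic _ (near_ch_dom G_lie Ac c1).
Qed.

Let iota (p : E) : E := ch_map c (ch_inv c p)^-1%g.

(** Conjugation as [q |-> (p q) p^-1]: this expresses [Ad] through the
    differential of the product, hence shows that it is differentiable in
    [p]. *)
Lemma Ad_chart_inv p z : ch_cod c p -> ch_dom c (ch_inv c p)^-1%g ->
  Ad c (ch_inv c p) z = dm ((p, iota p), (dm ((p, o), (0, z)), 0)).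
Proof.
move=> cp ip.
(* [m (p, o) = p], but the chain rule wants the point as an image under [m]. *)
have piU : U (m (p, o), iota p).
  rewrite m_l//; split; first by split; [|exact: (ch_map_cod G_lie Ac)].
  by rewrite /= (ch_mapK G_lie Ac)// mulgV.
have md := strict_diff_comp (strict_diff_pair (strict_diff_cst o p)
  (strict_diff_id o)) (m_diff (U_l cp)).
have := strict_diff_comp (strict_diff_pair md (strict_diff_cst o (iota p)))
  (m_diff piU).
suff /strict_diff_near /[apply] /(strict_diffE hE) : \forall q \near o,
    (m \o (fun q => ((m \o (fun q => (p, q))) q, iota p))) q =
    ch_map c (ch_inv c p * ch_inv c q * (ch_inv c p)^-1)%g.
  by move/(congr1 (@^~ z)) => /=; rewrite m_l.
have pqc : (ch_inv c p * ch_inv c q)%g @[q --> o] --> ch_inv c p.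
  rewrite -[X in _ --> X]mulg1; apply: (mulg_cvg G_lie); first exact: cvg_cst.
  exact: ch_inv_cvg1.
have := pqc _ (near_ch_dom G_lie Ac (ch_inv_dom G_lie Ac cp)).
move=> pqd; near=> q; rewrite /m /iota /chart_mul /= !(ch_mapK G_lie Ac)//.
by near: q.
Unshelve. all: by end_near. Qed.

Let Ad_chart_inv_diff z :
  exists L, strict_diff (fun p => Ad c (ch_inv c p) z) o L.
Proof.
have [|L iL] := chart_inv_strict_diff G_lie Ac Ac co.
  by rewrite ch_inv_chart1 invg1.
have io : iota o = o by rewrite /iota ch_inv_chart1 invg1.
have d1 := strict_diff_comp (strict_diff_pair
  (strict_diff_pair (strict_diff_id o) (strict_diff_cst o o))
  (strict_diff_cst o (0, z))) (dm_diff (0, z) (U_l co)).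
have oiU : U (o, iota o) by rewrite io; exact: U_l.
have d2 := strict_diff_comp (strict_diff_pair
  (strict_diff_pair (strict_diff_id o) iL)
  (strict_diff_pair d1 (strict_diff_cst o 0))) (dm_diff _ oiU).
eexists; apply: strict_diff_near d2.
near=> p; rewrite Ad_chart_inv//; near: p; first exact: near_cod.
exact: near_inv_dom.
Unshelve. all: by end_near. Qed.

(** From [p q = (p q p^-1) p]: the left invariant field with value [z] at 1 is
    the right translate of [Ad p z]. *)
Lemma left_inv_field_Ad p z : ch_cod c p ->
  left_inv_field c z p = dm ((o, p), (Ad c (ch_inv c p) z, 0)).
Proof.
move=> cp; rewrite /left_inv_field.
have := U_r cp; rewrite -[X in U (X, _)](conj_chart1 (ch_inv c p)) => opU.
have := strict_diff_comp (strict_diff_pair (Ad_strict_diff (ch_inv c p))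
  (strict_diff_cst o p)) (m_diff opU).
suff /strict_diff_near /[apply] /(strict_diffE hE) -> : \forall q \near o,
    (m \o (fun q => (ch_map c (ch_inv c p * ch_inv c q * (ch_inv c p)^-1)%g, p))) q
    = ch_map c (ch_inv c p * ch_inv c q)%g.
  by rewrite /= conj_chart1.
have := near_conj_dom (ch_inv c p); apply: filterS => q qd.
by rewrite /m /chart_mul /= (ch_mapK G_lie Ac)// mulgVK.
Qed.

(** Write [X_z] for the left invariant field, [D] for the second differential
    of the product at (1, 1).  Differentiating [left_inv_field_Ad] in direction
    [x] gives [dX_z (x) = D ((z, 0), (0, x)) + L x], where [L] is the derivative
    of [p |-> Ad p z]; and [left_inv_fieldE] gives
    [dX_x (z) = D ((0, x), (z, 0))].  By symmetry of [D] the difference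
    [dX_z (x) - dX_x (z)], which is the bracket, is [L x]. *)
Lemma Ad_lie_bracket z :
  strict_diff (fun p => Ad c (ch_inv c p) z) o (fun x => lie_bracket c x z).
Proof.
have [L aL] := Ad_chart_inv_diff z.
suff -> : (fun x => lie_bracket c x z) = L by [].
apply/funext => x; rewrite /lie_bracket /field_bracket -/o.
rewrite !left_inv_field_chart1.
have X_diff y : strict_diff (left_inv_field c y) o
    (fun v => dderive dm ((o, o), (0, y)) ((v, 0), 0)).
  have := strict_diff_comp (strict_diff_pair
    (strict_diff_pair (strict_diff_id o) (strict_diff_cst o o))
    (strict_diff_cst o (0, y))) (dm_diff (0, y) (U_l co)).
  apply: strict_diff_near; apply: filterS near_cod => p cp.
  by rewrite left_inv_fieldE.
have Xz_diff : strict_diff (left_inv_field c z) o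
    (fun v => dderive dm ((o, o), (z, 0)) ((0, v), (L v, 0))).
  have zE : z = Ad c (ch_inv c o) z by rewrite ch_inv_chart1 Ad1.
  have := @dm_diff _ (Ad c (ch_inv c o) z, 0) (U_l co).
  move=> /(strict_diff_comp (strict_diff_pair
    (strict_diff_pair (strict_diff_cst o o) (strict_diff_id o))
    (strict_diff_pair aL (strict_diff_cst o 0)))).
  rewrite -zE; apply: strict_diff_near; apply: filterS near_cod => p cp.
  by rewrite left_inv_field_Ad.
rewrite (strict_diffE hE Xz_diff) (strict_diffE hE (X_diff x)).
have D_lin := strict_diff_linear hE (dm_diff (z, 0) (U_l co)).
(* Split [D] into the mixed second derivative and the contribution of [L]. *)
have -> : ((0, x), (L x, 0)) = 1 *: ((0, x), (0, 0)) + ((0, 0), (L x, 0))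
    :> (E * E) * (E * E).
  by rewrite scale1r; congr (_, _); congr (_, _); rewrite ?addr0 ?add0r.
rewrite D_lin scale1r.
(* [dm] is linear in its second argument, and right translation by 1 is the
   identity. *)
have Lx : dderive dm ((o, o), (z, 0)) ((0, 0), (L x, 0)) = L x.
  have dL := dm_diff (z, 0) (U_l co).
  apply: (strict_diff_unique hE dL); rewrite -[X in _ --> X]dm_chart1_l.
  have cL : (fun _ : R => dm ((o, o), (L x, 0))) @ (0 : R)^'
    --> dm ((o, o), (L x, 0)) by exact: cvg_cst.
  apply: cvg_trans cL; apply: near_eq_cvg; near=> h.
  have h0 : h != 0 by near: h; exact: nbhs_dnbhs_neq.
  rewrite /diff_quotient.
  have -> : ((o, o), (z, 0)) + h *: ((0, 0), (L x, 0)) =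
            ((o, o), h *: (L x, 0) + (z, 0)) :> (E * E) * (E * E).
    have oE : (o, o) + h *: (0 : E * E) = (o, o) by rewrite scaler0 addr0.
    by apply/pair_equal_spec; split; [exact: oE|exact: addrC].
  by rewrite (dm_linear (U_l co)) addrK scalerA mulVf// scale1r.
rewrite Lx.
have Uoo : nbhs (o, o) U.
  by apply: open_nbhs_nbhs; split; [exact: (chart_mul_dom_open G_lie)|exact: U_l].
have -> := @dderive_symmetric _ _ _ m U (o, o) (z, 0) (0, x)
  (fun v => dderive dm ((o, o), v)) hE Uoo m_diff (fun v => dm_diff v (U_l co)).
by rewrite addrAC subrr add0r.
Unshelve. all: by end_near. Qed.

End AdjointAction.

Section AdjointCurves.
Context {R : realType} {E : tvsType R} {G : groupTopologicalType}.
Context (A : set (chart G E)) (G_lie : is_lie_group A).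
Context (c : chart G E) (Ac : A c) (c1 : ch_dom c 1%g).

Let hE : hausdorff_space E. Proof. by case: G_lie => -[]. Qed.

Lemma lie_bracketC x y : lie_bracket c x y = - lie_bracket c y x.
Proof. by rewrite /lie_bracket /field_bracket opprB. Qed.

Lemma lie_bracket_linear_l z : linear (fun x => lie_bracket c x z).
Proof. exact: strict_diff_linear hE (Ad_lie_bracket G_lie Ac c1 z). Qed.

Lemma lie_bracket_linear_r x : linear (lie_bracket c x).
Proof.
move=> a u v; rewrite (lie_bracketC x (a *: u + v)) (lie_bracketC x u).
by rewrite (lie_bracketC x v) lie_bracket_linear_l opprD scalerN.
Qed.

(** From [Ad (k (t + h)) = Ad (k (t + h) (k t)^-1) Ad (k t)], where the first
    factor passes through 1 at [h = 0] with velocity [x]. *)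
Lemma Ad_curve_deriv (k : R -> G) (t : R) (x z : E) :
  (k (t + h) * (k t)^-1)%g @[h --> (0 : R)^'] --> (1%g : G) ->
  h^-1 *: (ch_map c (k (t + h) * (k t)^-1)%g - chart1 c) @[h --> (0 : R)^']
    --> x ->
  curve_deriv (fun s => Ad c (k s) z) t (lie_bracket c x (Ad c (k t) z)).
Proof.
move=> k1 kx; set y := Ad c (k t) z.
have oc : (fun _ : R => chart1 c) @ (0 : R)^' --> chart1 c by exact: cvg_cst.
have h0 : (fun h : R => h) @ (0 : R)^' --> (0 : R)^' by exact: cvg_id.
apply: cvg_trans (strict_diff_cvg (Ad_lie_bracket G_lie Ac c1 y) oc kx h0).
apply: near_eq_cvg; near=> h.
have hn0 : h != 0 by near: h; exact: nbhs_dnbhs_neq.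
have kd : ch_dom c (k (t + h) * (k t)^-1)%g.
  by near: h; exact: k1 _ (near_ch_dom G_lie Ac c1).
rewrite scalerA mulfV// scale1r [chart1 c + _]addrC subrK.
rewrite (ch_mapK G_lie Ac)// (ch_inv_chart1 G_lie Ac c1) (Ad1 G_lie Ac c1) /y.
by rewrite -(AdM G_lie Ac c1) mulgVK.
Unshelve. all: by end_near. Qed.

Section Exponential.
Context (e : E -> G) (e_exp : is_exponential c A e).

Lemma expD s t x : e ((s + t) *: x) = (e (s *: x) * e (t *: x))%g.
Proof. by case: e_exp => _ /(_ x)[+ _]. Qed.

Lemma exp0 : e 0 = 1%g.
Proof.
have := expD 0 0 0; rewrite addr0 scaler0 => /(congr1 (fun g => (e 0)^-1 * g)%g).
by rewrite mulVg mulKg.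
Qed.

Lemma Ad_exp_deriv x y t :
  curve_deriv (fun s => Ad c (e (s *: x)) y) t
    (lie_bracket c x (Ad c (e (t *: x)) y)).
Proof.
have eE h : (e ((t + h) *: x) * (e (t *: x))^-1)%g = e (h *: x).
  by rewrite addrC expD mulgK.
apply: (Ad_curve_deriv (k := fun s => e (s *: x))).
  under eq_cvg do rewrite eE.
  rewrite -exp0; apply: cvg_comp; last by case: e_exp => -[ec _] _; exact: ec.
  rewrite -(scale0r x); apply: tvs_cvgZ; first exact: cvg_dnbhs.
  exact: cvg_cst.
case: e_exp => _ /(_ x)[_]; apply: cvg_trans; apply: near_eq_cvg.
apply: nearW => h.
by rewrite /= eE /diff_quotient scale0r exp0 add0r /chart1 [h *: 1]mulr1.
Qed.

(** Compare the derivatives at [t] of [s |-> Ad (exp (sx)) y] obtained by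
    splitting off [exp (tx)] on the left and on the right. *)
Lemma Ad_exp_lie_bracket x y t :
  Ad c (e (t *: x)) (lie_bracket c x y) =
  lie_bracket c x (Ad c (e (t *: x)) y).
Proof.
have d0 := @Ad_exp_deriv x y 0; rewrite scale0r exp0 (Ad1 G_lie Ac c1) in d0.
have := curve_deriv_linear (Ad_linear G_lie Ac c1 (e (t *: x)))
  (@Ad_continuous _ _ _ _ G_lie _ Ac c1 (e (t *: x))) d0.
move=> /(cvg_unique hE); apply.
apply: cvg_trans (@Ad_exp_deriv x y t); apply: near_eq_cvg.
apply: nearW => h /=.
by rewrite -!(AdM G_lie Ac c1) -!expD addr0 add0r.
Qed.

(** The curve [L (Ad (exp (tx)) [x, y])] has derivative
    [L [x, [x, Ad (exp (tx)) y]] = 0], and it is the derivative of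
    [L (Ad (exp (tx)) y)]. *)
Lemma Ad_exp_affine (F : tvsType R) (L : E -> F) x :
  hausdorff_space F -> linear L -> continuous L ->
  (forall z, L (lie_bracket c x (lie_bracket c x z)) = 0) ->
  forall t y, L (Ad c (e (t *: x)) y) = L y + t *: L (lie_bracket c x y).
Proof.
move=> hF Llin Lc Lxx t y.
have L1 s : L (Ad c (e (s *: x)) (lie_bracket c x y)) = L (lie_bracket c x y).
  rewrite (curve_const_line (g := fun r => L (Ad c (e (r *: x)) _)))//=.
    by rewrite scale0r exp0 (Ad1 G_lie Ac c1).
  move=> r; rewrite -(Lxx (Ad c (e (r *: x)) y)) -Ad_exp_lie_bracket.
  by apply: (curve_deriv_linear Llin Lc); exact: Ad_exp_deriv.
apply/eqP; rewrite -subr_eq; apply/eqP.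
rewrite (curve_const_line (g := fun r =>
  L (Ad c (e (r *: x)) y) - r *: L (lie_bracket c x y)))//=.
  by rewrite !scale0r exp0 (Ad1 G_lie Ac c1) subr0.
move=> r; rewrite -(subrr (L (lie_bracket c x y))); apply: curve_derivB.
  rewrite -[X in curve_deriv _ _ X](L1 r) Ad_exp_lie_bracket.
  by apply: (curve_deriv_linear Llin Lc); exact: Ad_exp_deriv.
exact: curve_deriv_scale.
Qed.

End Exponential.
End AdjointCurves.

(** * Semi-equicontinuous orbits and invariant cones *)

Section TrivialOrbits.
Context {R : realType} {E : tvsType R} {G : groupTopologicalType}.
Context (A : set (chart G E)) (G_lie : is_lie_group A).
Context (c : chart G E) (Ac : A c) (c1 : ch_dom c 1%g).

Local Notation br := (lie_bracket c).

Let hE : hausdorff_space E. Proof. by case: G_lie => -[]. Qed.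

Let bracket_r x : linear (lie_bracket c x) :=
  lie_bracket_linear_r G_lie Ac c1 x.

Let linear_at0 (F F' : lmodType R) (f : F -> F') : linear f -> f 0 = 0.
Proof. by move=> /(_ (-1) 0 0); rewrite scaler0 addr0 scaleN1r addNr. Qed.

Let linear_opp (F F' : lmodType R) (f : F -> F') x : linear f -> f (- x) = - f x.
Proof.
move=> flin; have := flin (-1) x 0.
by rewrite (linear_at0 flin) !addr0 !scaleN1r.
Qed.

Lemma bracket_span_lie_bracket (S T : set E) x y : S x -> T y ->
  bracket_span c S T (br x y).
Proof.
move=> Sx Ty; exists 1%N, (fun=> 1), (fun=> (br x y)); split.
  by move=> _; exists x => //; exists y.
by rewrite big_ord1 scale1r.
Qed.

Lemma lin_span_eq0 (F : lmodType R) (L : E -> F) (S : set E) : linear L ->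
  (forall x, S x -> L x = 0) -> forall x, lin_span S x -> L x = 0.
Proof.
move=> Llin LS x [n [a [s [Ss ->]]]].
elim/big_ind: _ => [|u v Lu Lv|i _]; first exact: linear_at0.
  by have := Llin 1 u v; rewrite !scale1r Lu Lv addr0.
by have := Llin (a i) (s i) 0; rewrite (LS (s i))// (linear_at0 Llin) scaler0 !addr0.
Qed.

(** The algebraic core, common to functionals ([L] in the dual) and to cones
    ([L = id]). *)
Lemma bracket_annihilated (F : lmodType R) (L : E -> F) : linear L ->
  (forall x, (forall z, L (br x (br x z)) = 0) -> forall y, L (br x y) = 0) ->
  nilpotent_lie c \/ abelian_on c (derived_algebra c) ->
  forall x y, L (br x y) = 0.
Proof.
move=> Llin Lsq [[n Cn]|Dab] x y; last first.
  have LD u v z : L (br (br u v) z) = 0.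
    apply: Lsq => w; rewrite Dab ?(linear_at0 Llin)//;
      exact: bracket_span_lie_bracket.
  by apply: Lsq => z; rewrite lie_bracketC linear_opp// LD oppr0.
have L_down k : (forall u, lower_central c k.+2 u -> L u = 0) ->
    forall u, lower_central c k.+1 u -> L u = 0.
  move=> LC; apply: lin_span_eq0 => // _ [u _ [v Cv <-]].
  rewrite lie_bracketC linear_opp//; apply/eqP; rewrite oppr_eq0; apply/eqP.
  apply: Lsq => z; rewrite [br v z]lie_bracketC linear_opp// linear_opp//.
  rewrite LC ?oppr0//; apply: bracket_span_lie_bracket => //=.
  exact: bracket_span_lie_bracket.
have L_top k : (forall u, lower_central c k.+1 u -> L u = 0) -> L (br x y) = 0.
  elim: k => [|k IHk] LC; last by apply: IHk; exact: L_down.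
  by apply: LC; exact: bracket_span_lie_bracket.
case: n Cn => [C0|n Cn].
  have : lower_central c 0 (br x y) by [].
  by rewrite C0 => ->; exact: linear_at0.
by apply: (L_top n) => u; rewrite Cn => ->; exact: linear_at0.
Qed.

Section Exponential.
Context (e : E -> G) (e_exp : is_exponential c A e).

(** An affine function of [t] that is bounded above has slope 0. *)
Lemma dual_seq_lie_bracket l x : dual_seq c l ->
  (forall z, l (br x (br x z)) = 0) -> forall y, l (br x y) = 0.
Proof.
move=> [[llin lc] [U [Uo [a Ua] [M UM]]]] lxx.
have blin : linear (l \o br x : E -> R^o).
  by move=> k u v /=; rewrite bracket_r llin.
apply: (linear_eq0_nbhs (a := a) blin (open_nbhs_nbhs (conj Uo Ua))) => y Uy /=.
have laff := Ad_exp_affine G_lie Ac c1 e_exp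
  (@norm_hausdorff R R^o) llin lc lxx.
have lM t : l y + t * l (br x y) <= M.
  have := laff t y; rewrite /= => /esym lyE; rewrite [X in X <= _]lyE.
  have := le_trans (lee_abs _) (UM y Uy); rewrite -lee_fin.
  apply: le_trans; apply: ereal_sup_ubound => /=.
  exists (coAd c (e (t *: x))^-1%g l); first by exists ((e (t *: x))^-1)%g.
  by rewrite /coAd /= invgK.
apply/eqP/negPn/negP => b0.
(* At this time the affine function takes the value [M + 1]. *)
have := lM ((M - l y + 1) / l (br x y)).
by rewrite divfK//; lra.
Qed.

(** The line [w + t [x, w]] lies in [W]; its asymptotic directions [[x, w]] and
    [- [x, w]] are therefore in the closure of [W]. *)
Lemma Ad_invariant_cone_lie_bracket (W : set E) x : convex_cone W ->
  pointed_cone W -> Ad_invariant c W -> interior W !=set0 ->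
  (forall z, br x (br x z) = 0) -> forall y, br x y = 0.
Proof.
move=> [_ Wcone] Wptd WAd [a aW] bxx.
apply: (linear_eq0_nbhs (a := a) (bracket_r x) aW) => w Ww.
have idlin : linear (id : E -> E) by [].
have idc : continuous (id : E -> E) by move=> ?; exact: cvg_id.
have Waff t : W (w + t *: br x w).
  rewrite -(@Ad_exp_affine _ _ _ _ G_lie _ Ac c1 _ e_exp _ id x hE idlin idc bxx).
  exact: WAd.
have closW (v : E) : (forall t : R, 0 < t -> W (t *: w + v)) -> closure W v.
  move=> Wv; have wv : (t *: w + v) @[t --> (0 : R)^'+] --> v.
    rewrite -[v in X in _ --> X]add0r -(scale0r w); apply: tvs_cvgD.
      by apply: tvs_cvgZ; [exact: cvg_at_right_filter|exact: cvg_cst].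
    exact: cvg_cst.
  apply: (closed_cvg (closure W) _ _ v wv); first exact: closed_closure.
  near=> t; apply: subset_closure; apply: Wv; near: t; exact: nbhs_right_gt.
suff : (closure W `&` (-%R @` closure W)) (br x w) by rewrite Wptd.
split.
  apply: closW => t t0; have := Wcone t _ t0 (Waff t^-1).
  by rewrite scalerDr scalerA mulfV ?gt_eqF// scale1r.
exists (- br x w); last by rewrite opprK.
apply: closW => t t0; have := Wcone t _ t0 (Waff (- t^-1)).
by rewrite scalerDr scalerA mulrN mulfV ?gt_eqF// scaleN1r.
Unshelve. all: by end_near. Qed.

End Exponential.

Section Stabilizer.
Context (l : E -> R^o) (l_lin : linear l) (l_cont : continuous l).
Context (l_br : forall x y, l (br x y) = 0).

Let stab : set G := [set g | forall y, l (Ad c g y) = l y].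

Let stabM g h : stab g -> stab h -> stab (g * h)%g.
Proof. by move=> sg sh y; rewrite (AdM G_lie Ac c1) sg sh. Qed.

Let stab1 : stab 1%g.
Proof. by move=> y; rewrite (Ad1 G_lie Ac c1). Qed.

(** In a chart around 1, join the point 1 to [p] by a segment: along it
    [l (Ad _ y)] has derivative [l [x, _] = 0], where [x] is the right
    logarithmic derivative of the segment. *)
Let stab_nbhs1 : \forall g \near (1%g : G), stab g.
Proof.
have [C [Co C1 Ccod Cc]] := nbhs_convex_open
  (near_ch_cod G_lie Ac (ch_map_cod G_lie Ac c1)).
have Cstab p : C p -> stab (ch_inv c p).
  move=> Cp y; set o := ch_map c 1%g in C1.
  pose k (t : R) := ch_inv c (o + t *: (p - o)).
  have kcod t : 0 <= t <= 1 -> ch_cod c (o + t *: (p - o)).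
    move=> /andP[t0 t1]; apply: Ccod.
    have := Cc p o t t0 t1 Cp C1.
    by rewrite scalerBl scale1r addrCA -scalerBr.
  have ld t : 0 <= t <= 1 -> curve_deriv (fun s => l (Ad c (k s) y)) t 0.
    move=> t01; have ct := kcod t t01.
    have k1 : ch_dom c (1 * k t * (k t)^-1)%g by rewrite mulgK.
    have [L Ld] := translation_strict_diff G_lie Ac ct k1.
    rewrite -(l_br (L (p - o)) (Ad c (k t) y)).
    apply: (curve_deriv_linear (L := l) l_lin l_cont).
    have kE h : k (t + h) = ch_inv c (o + t *: (p - o) + h *: (p - o)).
      by rewrite /k scalerDl addrA.
    apply: (Ad_curve_deriv G_lie Ac c1).
      rewrite -(mulgV (k t)); apply: (mulg_cvg G_lie); last exact: cvg_cst.
      under eq_cvg do rewrite kE.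
      apply: cvg_comp; last exact: (ch_inv_cvg G_lie Ac ct).
      apply: cvg_shift; [exact: cvg_cst|exact: cvg_cst|exact: cvg_id].
    apply: cvg_trans (strict_diff_cvg_dir (v := p - o) Ld).
    apply: near_eq_cvg; apply: nearW => h.
    by rewrite /diff_quotient kE !mul1g mulgV.
  have := curve_const (@norm_hausdorff R R^o) ld ler01.
  rewrite /k scale0r addr0 scale1r addrC subrK => <-.
  by rewrite (ch_mapK G_lie Ac c1) (Ad1 G_lie Ac c1).
have gC : \forall g \near (1%g : G), C (ch_map c g).
  by apply: (ch_map_cvg G_lie Ac c1); exact: open_nbhs_nbhs.
near=> g; rewrite -(ch_mapK G_lie Ac (g := g)); last first.
  by near: g; exact: (near_ch_dom G_lie Ac c1).
by apply: Cstab; near: g.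
Unshelve. all: by end_near. Qed.

Let stab_near g : \forall h \near g, stab (h * g^-1)%g.
Proof.
have : (h * g^-1)%g @[h --> g] --> (1%g : G).
  rewrite -(mulgV g); apply: (mulg_cvg G_lie); first exact: cvg_id.
  exact: cvg_cst.
by move/(_ _ stab_nbhs1).
Qed.

(** A subgroup that contains a neighbourhood of 1 is open and closed. *)
Lemma Ad_stabilizer : connected [set: G] -> forall g y, l (Ad c g y) = l y.
Proof.
move=> Gconn; suff stabT : stab = setT.
  by move=> g; have : stab g by rewrite stabT.
apply: Gconn; first by exists 1%g.
- exists stab; last by rewrite setTI.
  rewrite openE => g sg; rewrite /interior.
  apply: filterS (stab_near g) => h sh.
  by rewrite -[h](mulgVK g); exact: stabM.
- exists stab; last by rewrite setTI.
  move=> g /(_ _ (stab_near g))[h [sh shg]] y.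
  by rewrite -[LHS](shg (Ad c g y)) -(AdM G_lie Ac c1) mulgVK.
Qed.

End Stabilizer.
End TrivialOrbits.

Theorem theorem5p1 (R : realType) (E : tvsType R) (G : groupTopologicalType)
    (A : set (chart G E)) (c : chart G E)
    (G_lie : is_lie_group A)
    (G_connected : connected [set: G])
    (c_atlas : A c) (c_one : ch_dom c 1%g)
    (G_exp : has_exponential c A)
    (g_nil_or_2solv : nilpotent_lie c \/ abelian_on c (derived_algebra c)) :
  [/\ dual_seq c `<=` annihilator (derived_algebra c),
      (forall l, dual_seq c l -> coadjoint_orbit c l = [set l])
    & (exists W : set E, [/\ convex_cone W, pointed_cone W,
         Ad_invariant c W & interior W !=set0]) ->
      abelian_on c [set: E]].
Proof.
case: G_exp => e e_exp.
have l_bracket l : dual_seq c l -> forall x y, l (lie_bracket c x y) = 0.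
  move=> lseq; apply: (bracket_annihilated G_lie c_atlas c_one) g_nil_or_2solv.
    by case: lseq => -[].
  by move=> x; exact: (dual_seq_lie_bracket G_lie c_atlas c_one e_exp).
split.
- move=> l lseq; have [[llin lcont] _] := lseq; split; first by split.
  by apply: (lin_span_eq0 llin) => _ [x _ [y _ <-]]; exact: l_bracket.
- move=> l lseq; have [[llin lcont] _] := lseq.
  have l_coAd g : coAd c g l = l.
    apply/funext => y; apply: (Ad_stabilizer G_lie c_atlas c_one llin lcont) => //.
    exact: l_bracket.
  apply/seteqP; split => [_ [g _ <-]|_ ->]; first exact: l_coAd.
  by exists 1%g => //; exact: l_coAd.
- move=> [W [Wcone Wptd WAd Wint]] x y _ _.
  have id_lin : linear (id : E -> E) by [].
  apply: (bracket_annihilated G_lie c_atlas c_one id_lin) g_nil_or_2solv _ _.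
  move=> z zz; exact: (Ad_invariant_cone_lie_bracket G_lie c_atlas c_one
    e_exp Wcone Wptd WAd Wint zz).
Qed.
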